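(* Let $K_i\in\mathbb{R}^{m\times n}$ jointly stabilize all sampled systems, i.e. $\rho(A_j+B_jK_i)<1$ for all $j\in[M]$, and let $\Delta_i=\widehat K_{i+1}-K_i$ be the policy-improvement direction at $K_i$. Then there exists $\bar\alpha_i>0$ such that for all $\alpha\in[0,\bar\alpha_i]$ the gain $K_i+\alpha\Delta_i$ is jointly stabilizing, i.e. $\rho(A_j+B_j(K_i+\alpha\Delta_i))<1$ for all $j\in[M]$.
   Context: Let $M\ge 1$, $[M]=\{1,\dots,M\}$, and let $(A_j,B_j)$, $j\in[M]$, be given (sampled) system matrices with $A_j\in\mathbb{R}^{n\times n}$, $B_j\in\mathbb{R}^{n\times m}$. Let $Q\in\mathbb{R}^{n\times n}$ be symmetric with $Q\succeq 0$ and $R\in\mathbb{R}^{m\times m}$ symmetric with $R\succ 0$. $\rho(\cdot)$ denotes the spectral radius. For a gain $K_i$ with $\rho(A_j+B_jK_i)<1$ for all $j\in[M]$, let $P_{j,i}$ and $\Sigma_{j,i}$ be the unique solutions of the Lyapunov equations $$P_{j,i}=Q+K_i^\top RK_i+(A_j+B_jK_i)^\top P_{j,i}(A_j+B_jK_i),$$ $$\Sigma_{j,i}=I+(A_j+B_jK_i)\Sigma_{j,i}(A_j+B_jK_i)^\top .$$ The policy-improvement target $\widehat K_{i+1}\in\mathbb{R}^{m\times n}$ is the unique solution of $$\sum_{j=1}^M\Big[(R+B_j^\top P_{j,i}B_j)\widehat K_{i+1}+B_j^\top P_{j,i}A_j\Big]\Sigma_{j,i}=0,$$ and $\Delta_i:=\widehat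 K_{i+1}-K_i$. *)

(* Defs.v *)
From HB Require Import structures.
From mathcomp Require Import all_boot all_order all_algebra.
From mathcomp Require Import all_classical all_reals.
From mathcomp Require Import complex.

Set Implicit Arguments.
Unset Strict Implicit.
Unset Printing Implicit Defensive.

Import Order.TTheory GRing.Theory Num.Theory.
Local Open Scope classical_set_scope.
Local Open Scope ring_scope.

(* The largest modulus of a complex eigenvalue. The set below is finite; it is
   nonempty unless n = 0, in which case sup gives 0. *)
Definition spectral_radius (R : realType) (n : nat) (A : 'M[R]_n) : R :=
  sup [set r : R | exists2 z : R[i],
         eigenvalue (map_mx (real_complex R) A) z & r = Normc.normc z].

Definition possemidefmx (R : realType) (n : nat) (S : 'M[R]_n) : Prop :=
  S^T = S /\ forall x : 'cV[R]_n, 0 <= (x^T *m S *m x) 0 0.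

Definition posdefmx (R : realType) (n : nat) (S : 'M[R]_n) : Prop :=
  S^T = S /\ forall x : 'cV[R]_n, x != 0 -> 0 < (x^T *m S *m x) 0 0.

Definition closed_loop (R : realType) (n m : nat)
    (A : 'M[R]_n) (B : 'M[R]_(n, m)) (K : 'M[R]_(m, n)) : 'M[R]_n :=
  A + B *m K.

Definition jointly_stabilizing (R : realType) (M n m : nat)
    (A : 'I_M -> 'M[R]_n) (B : 'I_M -> 'M[R]_(n, m)) (K : 'M[R]_(m, n)) : Prop :=
  forall j : 'I_M, spectral_radius (closed_loop (A j) (B j) K) < 1.

(* For a Schur stable closed loop the solutions P and S of the next two
   equations exist and are unique. *)
Definition cost_lyapunov (R : realType) (n m : nat)
    (A : 'M[R]_n) (B : 'M[R]_(n, m)) (Qc : 'M[R]_n) (Rc : 'M[R]_m)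
    (K : 'M[R]_(m, n)) (P : 'M[R]_n) : Prop :=
  P = Qc + K^T *m Rc *m K + (closed_loop A B K)^T *m P *m closed_loop A B K.

Definition covariance_lyapunov (R : realType) (n m : nat)
    (A : 'M[R]_n) (B : 'M[R]_(n, m)) (K : 'M[R]_(m, n)) (S : 'M[R]_n) : Prop :=
  S = 1%:M + closed_loop A B K *m S *m (closed_loop A B K)^T.

(* Linear in Khat, and uniquely solvable when Rc is positive definite, the P j
   are positive semidefinite and the S j are positive definite. *)
Definition improvement_target (R : realType) (M n m : nat)
    (A : 'I_M -> 'M[R]_n) (B : 'I_M -> 'M[R]_(n, m)) (Rc : 'M[R]_m)
    (P S : 'I_M -> 'M[R]_n) (Khat : 'M[R]_(m, n)) : Prop :=
  \sum_(j < M) (((Rc + (B j)^T *m P j *m B j) *m Khat + (B j)^T *m P j *m A j)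
                  *m S j) = 0.

(* Main.v *)
(** Schur stability is an open condition along any line a |-> F + a G: the
    characteristic polynomial has coefficients that are polynomial in a.
    Roots are controlled without compactness: if p is the product of n factors
    X - z with |z| < 1, then |p(x)| >= prod (1 - |z|) |x|^n for |x| >= 1,
    whereas a polynomial of degree at most n is bounded there by |x|^n times
    the sum of the moduli of its coefficients. *)
Require Import Defs.
From HB Require Import structures.
From mathcomp Require Import all_boot all_order all_algebra.
From mathcomp Require Import all_classical all_reals.
From mathcomp Require Import complex polyrcf.

Set Implicit Arguments.
Unset Strict Implicit.
Unset Printing Implicit Defensive.

Import Order.TTheory GRing.Theory Num.Theory.
Local Open Scope ring_scope.

Lemma common_radius (R : realFieldType) (I : finType) (P : I -> R -> Prop) :
    (forall i, exists d, 0 < d /\ forall a, 0 <= a <= d -> P i a) ->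
  exists d, 0 < d /\ forall i a, 0 <= a <= d -> P i a.
Proof.
(* The default value [1] keeps the radius positive when [I] is empty. *)
move=> /choice[d dP]; exists (\big[Order.min/1]_i d i); split.
  apply: (big_ind (fun x => 0 < x)) => // [x y x0 y0|i _].
    by rewrite lt_min x0.
  by have [] := dP i.
move=> i a /andP[a0 ale]; have [_] := dP i; apply; rewrite a0 /=.
by apply: le_trans ale _; exact: bigmin_le.
Qed.

(** At a root [x] of [q], [|p(x)| = |(q - p)(x)|]. If [|x| >= 1], this one number obeys both the
    lower bound from the factors of [p] and the upper bound from the coefficients of [q - p], which
    the strict inequality makes incompatible. *)
Lemma root_perturb_lt1 (F : numFieldType) (rs : seq F) (p q : {poly F}) (x : F) :
    p = \prod_(z <- rs) ('X - z%:P) -> (forall z, z \in rs -> `|z| < 1) ->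
    (size q <= size p)%N ->
    \sum_(i < size p) `|q`_i - p`_i| < \prod_(z <- rs) (1 - `|z|) ->
  root q x -> `|x| < 1.
Proof.
move=> pE rs1 sqp dlt /eqP qx.
have sp : size p = (size rs).+1 by rewrite pE size_prod_XsubC.
(* The order on [F] may be partial, but norms are real, hence comparable with 1. *)
rewrite real_ltNge ?normr_real ?real1 //; apply/negP => x1.
have x0 : 0 < `|x| by exact: lt_le_trans x1.
have le1 : `|p.[x]| <= (\sum_(i < size p) `|q`_i - p`_i|) * `|x| ^+ size rs.
  have -> : `|p.[x]| = `|(q - p).[x]| by rewrite hornerD hornerN qx add0r normrN.
  have sd : (size (q - p)%R <= size p)%N.
    by rewrite (leq_trans (size_polyD _ _))// size_polyN geq_max sqp leqnn.
  rewrite (horner_coef_wide _ sd) mulr_suml.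
  apply: le_trans (ler_norm_sum _ _ _) _; apply: ler_sum => i _.
  rewrite normrM coefB normrX ler_wpM2l// ler_weXn2l//.
  by rewrite -ltnS -sp.
have le2 : (\prod_(z <- rs) (1 - `|z|)) * `|x| ^+ size rs <= `|p.[x]|.
  (* The power of [|x|] is spread over the factors, and each satisfies
     [|x - z| >= |x| - |z| >= (1 - |z|) |x|] because [|x| >= 1]. *)
  rewrite pE horner_prod normr_prod -(count_predT rs) -iter_mulr_1 -big_const_seq.
  rewrite -big_split big_seq [leRHS]big_seq /=; apply: ler_prod => z /rs1 z1.
  rewrite mulr_ge0 ?subr_ge0 ?(ltW z1)//= hornerXsubC.
  apply: le_trans (lerB_dist _ _); rewrite mulrBl mul1r lerB//.
  by rewrite ler_peMr.
have := le_trans le2 le1.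
by rewrite ler_pM2r ?exprn_gt0// => /(lt_le_trans dlt); rewrite ltxx.
Qed.

Lemma normc_normr (R : rcfType) (z : R[i]) : `|z| = (Normc.normc z)%:C%C.
Proof. by case: z. Qed.

Lemma normc_real (R : rcfType) (a : R) : `|a%:C%C| = `|a|%:C%C.
Proof. by rewrite normc_normr /= expr0n addr0 sqrtr_sqr. Qed.

(** The characteristic polynomial splits over [R[i]], so the supremum is bounded by a maximum over
    finitely many roots, and strict bounds survive a finite maximum. *)
Lemma spectral_radius_lt1P (R : realType) n (A : 'M[R]_n) :
  spectral_radius A < 1 <->
  forall z : R[i], root (map_poly (real_complex R) (char_poly A)) z -> `|z| < 1.
Proof.
rewrite map_char_poly; set p := char_poly _.
have [rs] := closed_field_poly_normal p.
rewrite (monicP (char_poly_monic _)) scale1r => pE.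
have rootE z : root p z = (z \in rs) by rewrite pE root_prod_XsubC.
have ubE : ubound [set r : R | exists2 z : R[i],
     eigenvalue (map_mx (real_complex R) A) z & r = Normc.normc z]
   (\big[Order.max/0]_(z <- rs) Normc.normc z).
  move=> _ [z + ->]; rewrite eigenvalue_root_char -/p rootE => zrs.
  exact: le_bigmax_seq zrs _.
rewrite /spectral_radius; split=> [lt1 z zp|lt1].
  rewrite normc_normr -[1]/(1%:C%C) ltcR; apply: le_lt_trans lt1.
  apply: ub_le_sup; first by exists (\big[Order.max/0]_(z <- rs) Normc.normc z).
  by exists z => //; rewrite eigenvalue_root_char.
set E := (X in sup X) in ubE *; have [->|/set0P E0] := eqVneq E set0.
  by rewrite sup0.
apply: (@le_lt_trans _ _ (\big[Order.max/0]_(z <- rs) Normc.normc z)).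
  exact: ge_sup.
rewrite big_seq; apply: (big_ind (fun x => x < 1)) => // [x y x1 y1|z zrs].
  by rewrite gt_max x1.
by rewrite -ltcR -normc_normr lt1// rootE.
Qed.

Lemma spectral_radius_lt1_perturb (R : realType) n (F G : 'M[R]_n) :
    spectral_radius F < 1 ->
  exists d : R, 0 < d /\ forall a, 0 <= a <= d -> spectral_radius (F + a *: G) < 1.
Proof.
move=> /spectral_radius_lt1P F1.
set p := map_poly _ _ in F1.
have [rs] := closed_field_poly_normal p.
rewrite (_ : lead_coef p = 1) ?scale1r => [pE|]; last first.
  by rewrite /p lead_coef_map_eq (monicP (char_poly_monic F)) ?rmorph1 ?oner_eq0.
have rs1 z : z \in rs -> `|z| < 1.
  by move=> zrs; apply: F1; rewrite pE root_prod_XsubC.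
pose e : R := \prod_(z <- rs) (1 - Normc.normc z).
have e0 : 0 < e.
  rewrite /e big_seq; apply: prodr_gt0 => z /rs1.
  by rewrite normc_normr -[1]/(1%:C%C) ltcR subr_gt0.
(* [W] is the characteristic polynomial of [F + X G] over [R[X]]. Specializing [X] to [a] makes each
   coefficient for [F + a G] a polynomial in [a], hence continuous. *)
pose W : {poly {poly R}} := char_poly (map_mx polyC F + 'X *: map_mx polyC G).
have WE a : map_poly (horner_eval a) W = char_poly (F + a *: G).
  rewrite map_char_poly; congr char_poly; apply/matrixP => i j.
  by rewrite !mxE /= /horner_eval hornerD hornerM hornerX !hornerC.
have coefW a i : (char_poly (F + a *: G))`_i = (W`_i).[a].
  by rewrite -WE coef_map.
have F0 i : (char_poly F)`_i = (W`_i).[0] by rewrite -coefW scale0r addr0.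
(* The margin [e] is shared equally among the [n + 1] coefficients. *)
have en0 : 0 < e / n.+1%:R by rewrite divr_gt0.
have [d [d0 dP]] : exists d, 0 < d /\ forall (i : 'I_n.+1) a, 0 <= a <= d ->
    `|(W`_i).[a] - (W`_i).[0]| < e / n.+1%:R.
  apply: common_radius => i; have [d d0 dP] := poly_cont 0 (W`_i) en0.
  (* Continuity gives an open interval; halving [d] yields a closed one. *)
  exists (d / 2); split; first by rewrite divr_gt0.
  move=> a /andP[a0 ad]; apply: dP; rewrite subr0 ger0_norm//.
  by apply: le_lt_trans ad _; rewrite ltr_pdivrMr// ltr_pMr// ltr1n.
exists d; split=> // a ad; apply/spectral_radius_lt1P => z.
have sp : size p = n.+1 by rewrite size_map_poly size_char_poly.
apply: root_perturb_lt1 pE rs1 _ _; first by rewrite sp size_map_poly size_char_poly.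
(* Both sides are images of real numbers, so the inequality descends from [R[i]] to [R]. *)
under [X in _ < X]eq_bigr do rewrite normc_normr -[1]/(1%:C%C) -rmorphB.
rewrite -rmorph_prod -/e sp.
under eq_bigr => i _ do
  rewrite /p !coef_map /= -rmorphB coefW F0 normc_real.
rewrite -rmorph_sum ltcR.
apply: (@lt_le_trans _ _ (\sum_(i < n.+1) e / n.+1%:R)).
  apply: ltr_sum => [|i _]; last exact: dP.
  by apply/hasP; exists ord0; rewrite ?mem_index_enum.
by rewrite sumr_const card_ord -(mulr_natr (e / _)) divfK ?pnatr_eq0.
Qed.

Theorem theorem1 (R : realType) (M n m : nat) (M_ge1 : (1 <= M)%N)
    (A : 'I_M -> 'M[R]_n) (B : 'I_M -> 'M[R]_(n, m))
    (Qc : 'M[R]_n) (Rc : 'M[R]_m)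
    (Qc_psd : possemidefmx Qc) (Rc_pd : posdefmx Rc)
    (K : 'M[R]_(m, n)) (K_stab : jointly_stabilizing A B K)
    (P S : 'I_M -> 'M[R]_n)
    (P_lyap : forall j : 'I_M, cost_lyapunov (A j) (B j) Qc Rc K (P j))
    (S_lyap : forall j : 'I_M, covariance_lyapunov (A j) (B j) K (S j))
    (Khat : 'M[R]_(m, n))
    (Khat_target : improvement_target A B Rc P S Khat) :
  let Delta := Khat - K in
  exists abar : R, 0 < abar /\
    forall alpha : R, 0 <= alpha <= abar ->
      jointly_stabilizing A B (K + alpha *: Delta).
Proof.
move=> Delta.
(* Each closed loop moves along a line with direction [B j *m Delta]. *)
have [d [d0 dP]] : exists d : R, 0 < d /\ forall j a, 0 <= a <= d ->
    spectral_radius (closed_loop (A j) (B j) K + a *: (B j *m Delta)) < 1.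
  by apply: common_radius => j; exact: spectral_radius_lt1_perturb.
exists d; split=> [|alpha alphad j]; first exact: d0.
by rewrite /closed_loop mulmxDr -scalemxAr addrA; exact: dP j alpha alphad.
Qed.
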